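(* Let $R>r>0$ and $d>0$ with $d^2=R^2-6Rr+r^2$, let $\Gamma,\gamma$ be circles of radii $R,r$ whose centres are at distance $d$, and put $a=\frac1r$, $A=-\frac1R$. For a Steiner $4$-chain with parent circles $\gamma,\Gamma$ and radii $r_1,\dots,r_4$, let $L=\sum_{j=1}^4 r_j$. Over all Steiner $4$-chains with parent circles $\gamma,\Gamma$, the maximum of $L$ is attained at the axial chain and equals $$-\frac{A^2-2Aa+a^2}{Aa(a+A)},$$ and the minimum of $L$ is attained at the two lateral chains and equals $$\frac{16(A+a)}{A^2-2Aa+a^2}.$$
   Context: A Steiner $4$-chain with parent circles $\gamma,\Gamma$ (where $\gamma$ lies inside the interior disk of $\Gamma$) is a sequence of circles $\delta_1,\dots,\delta_4$ such that $\delta_i$ and $\delta_{i+1}$ are externally tangent for all $i$ (indices mod $4$), and each $\delta_i$ is externally tangent to $\gamma$ and internally tangent to $\Gamma$. Let $\ell$ be the line through the centres of $\gamma$ and $\Gamma$. The axial chain is the Steiner $4$-chain two of whose circles have centres on $\ell$ (it contains the circle of maximal radius $\frac{R-r+d}{2}$ and the circle of minimal radius $\frac{R-r-d}{2}$). The lateral chains are the two Steiner $4$-chains symmetric with respect to $\ell$ none of whose circles has its centre on $\ell$.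
   Formalization: The four circles of a Steiner 4-chain are required to be distinct (otherwise δ1,δ2,δ1,δ2 can exceed the stated maximum), and the ''two lateral chains'' are the two opposite cyclic orders of one and the same set of four circles. *)

(* Defs.v *)
From HB Require Import structures.
From mathcomp Require Import all_boot all_order all_algebra.

Set Implicit Arguments.
Unset Strict Implicit.
Unset Printing Implicit Defensive.

Import Order.TTheory GRing.Theory Num.Theory.
Local Open Scope ring_scope.

Section Plane.
Variable K : rcfType.

Definition point := 'rV[K]_2.

Definition dot (u v : point) : K := \sum_i u 0 i * v 0 i.

Definition dist (p q : point) : K := Num.sqrt (dot (p - q) (p - q)).

Definition on_line (p q x : point) : Prop := exists t : K, x = p + t *: (q - p).

(* Orthogonal reflection in the line through p and q, meaningful for p != q:
   twice the foot of the perpendicular from x, minus x. *)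
Definition reflect_point (p q x : point) : point :=
  let v := q - p in
  2%:R *: (p + (dot (x - p) v / dot v v) *: v) - x.

Record circle := Circle {
  center : point;
  radius : K;
  radius_gt0 : 0 < radius
}.

Definition on_circle (c : circle) (x : point) : Prop :=
  dist x (center c) = radius c.

Definition in_open_disk (c : circle) (x : point) : Prop :=
  dist x (center c) < radius c.

Definition lies_inside (c c' : circle) : Prop :=
  forall x, on_circle c x -> in_open_disk c' x.

Definition externally_tangent (c c' : circle) : Prop :=
  dist (center c) (center c') = radius c + radius c'.

(* c is the inner circle. *)
Definition internally_tangent (c c' : circle) : Prop :=
  radius c < radius c' /\ dist (center c) (center c') = radius c' - radius c.

Definition reflect_circle (p q : point) (c : circle) : circle :=
  Circle (reflect_point p q (center c)) (radius_gt0 c).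

(* Arithmetic in 'Z_4 makes the indices cyclic. The circles are required to be
   distinct: otherwise d1, d2, d1, d2 with d1 tangent to d2 would be a chain. *)
Definition steiner4_chain (gam Gam : circle) (delta : 'Z_4 -> circle) : Prop :=
  [/\ lies_inside gam Gam,
      injective delta,
      forall i, externally_tangent (delta i) (delta (i + 1)),
      forall i, externally_tangent (delta i) gam
    & forall i, internally_tangent (delta i) Gam].

Definition axial_chain (gam Gam : circle) (delta : 'Z_4 -> circle) : Prop :=
  steiner4_chain gam Gam delta /\
  exists i j, [/\ i != j,
    on_line (center gam) (center Gam) (center (delta i))
  & on_line (center gam) (center Gam) (center (delta j))].

Definition lateral_chain (gam Gam : circle) (delta : 'Z_4 -> circle) : Prop :=
  [/\ steiner4_chain gam Gam delta,
      forall i, exists j,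
        delta j = reflect_circle (center gam) (center Gam) (delta i)
    & forall i, ~ on_line (center gam) (center Gam) (center (delta i))].

Definition same_circles (delta eps : 'Z_4 -> circle) : Prop :=
  forall c, (exists i, delta i = c) <-> (exists i, eps i = c).

(* The same cyclic sequence, up to the choice of the initial circle. *)
Definition same_cyclic_sequence (delta eps : 'Z_4 -> circle) : Prop :=
  exists k, forall i, eps i = delta (i + k).

Definition radii_sum (delta : 'Z_4 -> circle) : K := \sum_i radius (delta i).

End Plane.

(* Main.v *)
(** In coordinates with origin at the centre of [gam] and first axis through
    the centre of [Gam], a circle of radius [rho] tangent to both parents is
    determined by a unit vector [(c, s)], where
    [1 / rho = ((R - r) + d * c) / (2 * R * r)] and the ordinate of its centre
    is [sqrt 2 * rho * s].  The relation [d^2 = R^2 - 6 R r + r^2] makes two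
    such circles externally tangent exactly when their unit vectors are
    orthogonal, so a Steiner 4-chain is the orbit of a unit vector under a
    quarter turn, in one of two senses.  The radii then add up to
    [4 R r (R - r) (R + r)^2 / (4 R r (R - r)^2 + d^4 (c s)^2)]
    with [0 <= (c s)^2 <= 1/4]; the axial chain is the case [c s = 0] and the
    lateral chains are the case [c^2 = s^2]. *)
Require Import Defs.
From HB Require Import structures.
From mathcomp Require Import all_boot all_order all_algebra.
From mathcomp Require Import ring lra.

Set Implicit Arguments.
Unset Strict Implicit.
Unset Printing Implicit Defensive.

Import Order.TTheory GRing.Theory Num.Theory.
Local Open Scope ring_scope.

(** * Cartesian coordinates adapted to the line of centres *)

Section Frame.
Variables (K : rcfType) (p q : point K).
Hypothesis pq : 0 < dist p q.

Lemma dotE (u v : point K) : dot u v = u 0 0 * v 0 0 + u 0 1 * v 0 1.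
Proof.
rewrite /dot big_ord_recl big_ord1.
by congr (_ + u _ _ * v _ _); apply: val_inj.
Qed.

Lemma row2_eq (u v : point K) : u 0 0 = v 0 0 -> u 0 1 = v 0 1 -> u = v.
Proof.
move=> h0 h1; apply/rowP => i; case: i => [[|[|//]] hi].
  by rewrite (_ : Ordinal hi = 0) //; apply: val_inj.
by rewrite (_ : Ordinal hi = 1) //; apply: val_inj.
Qed.

Lemma dist_ge0 (x y : point K) : 0 <= dist x y.
Proof. exact: sqrtr_ge0. Qed.

Lemma dist_sqrE (x y : point K) :
  dist x y ^+ 2 = (x 0 0 - y 0 0) ^+ 2 + (x 0 1 - y 0 1) ^+ 2.
Proof.
rewrite /dist sqr_sqrtr dotE !mxE; first by ring.
by rewrite addr_ge0 // -expr2 sqr_ge0.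
Qed.

Lemma dist_eqP (x y : point K) (e : K) :
  0 <= e -> dist x y = e <-> dist x y ^+ 2 = e ^+ 2.
Proof.
move=> e0; split=> [->//|/eqP].
by rewrite eqrXn2 ?dist_ge0 // => /eqP.
Qed.

(* Cartesian coordinates with origin [p] and first axis directed towards [q]. *)
Definition abscissa (x : point K) : K := dot (x - p) (q - p) / dist p q.
Definition ordinate (x : point K) : K :=
  ((x 0 1 - p 0 1) * (q 0 0 - p 0 0) - (x 0 0 - p 0 0) * (q 0 1 - p 0 1))
    / dist p q.
Definition point_at (a b : K) : point K :=
  p + \row_i ((if i == 0 :> 'I_2
              then a * (q 0 0 - p 0 0) - b * (q 0 1 - p 0 1)
              else a * (q 0 1 - p 0 1) + b * (q 0 0 - p 0 0)) / dist p q).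

Let axis0 := (q 0 0 - p 0 0) / dist p q.
Let axis1 := (q 0 1 - p 0 1) / dist p q.

Let axis_unit : axis0 ^+ 2 + axis1 ^+ 2 = 1.
Proof.
rewrite /axis0 /axis1 !exprMn exprVn -mulrDl.
have -> : (q 0 0 - p 0 0) ^+ 2 + (q 0 1 - p 0 1) ^+ 2 = dist p q ^+ 2.
  by rewrite dist_sqrE; ring.
by rewrite divff // expf_neq0 // gt_eqF.
Qed.

Let abscissaE x :
  abscissa x = (x 0 0 - p 0 0) * axis0 + (x 0 1 - p 0 1) * axis1.
Proof. by rewrite /abscissa dotE !mxE /axis0 /axis1; ring. Qed.

Let ordinateE x :
  ordinate x = (x 0 1 - p 0 1) * axis0 - (x 0 0 - p 0 0) * axis1.
Proof. by rewrite /ordinate /axis0 /axis1; ring. Qed.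

Let point_at0 a b : point_at a b 0 0 = p 0 0 + a * axis0 - b * axis1.
Proof. by rewrite /point_at !mxE /= /axis0 /axis1; ring. Qed.

Let point_at1 a b : point_at a b 0 1 = p 0 1 + a * axis1 + b * axis0.
Proof. by rewrite /point_at !mxE /= /axis0 /axis1; ring. Qed.

Lemma abscissa_point_at a b : abscissa (point_at a b) = a.
Proof.
(* Writing 1 as the squared length of the axis direction turns the goal into a polynomial
   identity. *)
rewrite abscissaE point_at0 point_at1 -[RHS]mulr1 -axis_unit; ring.
Qed.

Lemma ordinate_point_at a b : ordinate (point_at a b) = b.
Proof.
rewrite ordinateE point_at0 point_at1 -[RHS]mulr1 -axis_unit; ring.
Qed.

Lemma point_atK x : point_at (abscissa x) (ordinate x) = x.
Proof.
apply: row2_eq; rewrite ?point_at0 ?point_at1 abscissaE ordinateE.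
  transitivity (p 0 0 + (x 0 0 - p 0 0) * (axis0 ^+ 2 + axis1 ^+ 2)).
    by ring.
  by rewrite axis_unit; ring.
transitivity (p 0 1 + (x 0 1 - p 0 1) * (axis0 ^+ 2 + axis1 ^+ 2)).
  by ring.
by rewrite axis_unit; ring.
Qed.

Lemma abscissa_ordinate_inj x y :
  abscissa x = abscissa y -> ordinate x = ordinate y -> x = y.
Proof. by move=> ha ho; rewrite -[x]point_atK ha ho point_atK. Qed.

Lemma dist_sqr_coord x y :
  dist x y ^+ 2
  = (abscissa x - abscissa y) ^+ 2 + (ordinate x - ordinate y) ^+ 2.
Proof.
rewrite dist_sqrE !abscissaE !ordinateE -[LHS]mulr1 -axis_unit; ring.
Qed.

Lemma abscissa_origin : abscissa p = 0.
Proof. by rewrite abscissaE; ring. Qed.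

Lemma ordinate_origin : ordinate p = 0.
Proof. by rewrite ordinateE; ring. Qed.

Lemma ordinate_axis : ordinate q = 0.
Proof. by rewrite /ordinate; ring. Qed.

Lemma abscissa_axis : abscissa q = dist p q.
Proof.
have dn0 : dist p q != 0 by rewrite gt_eqF.
rewrite abscissaE -[RHS]mulr1 -axis_unit /axis0 /axis1; field.
exact: dn0.
Qed.

Lemma on_line_ordinate x : on_line p q x <-> ordinate x = 0.
Proof.
have dn0 : dist p q != 0 by rewrite gt_eqF.
split=> [[t ->]|hx].
  by rewrite /ordinate !mxE; ring.
exists (abscissa x / dist p q); apply: row2_eq;
  by rewrite -[in LHS](point_atK x) hx ?point_at0 ?point_at1 !mxE
             /axis0 /axis1; ring.
Qed.

Lemma reflect_pointE x :
  reflect_point p q x = point_at (abscissa x) (- ordinate x).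
Proof.
have dn0 : dist p q != 0 by rewrite gt_eqF.
have dot_pq : dot (q - p) (q - p) = dist p q ^+ 2.
  by rewrite dist_sqrE dotE !mxE; ring.
have coef : dot (x - p) (q - p) / dot (q - p) (q - p) = abscissa x / dist p q.
  by rewrite dot_pq /abscissa; field.
have x0 := point_at0 (abscissa x) (ordinate x).
have x1 := point_at1 (abscissa x) (ordinate x).
rewrite point_atK in x0 x1.
rewrite /reflect_point coef; apply: row2_eq; rewrite ?point_at0 ?point_at1 !mxE.
  by rewrite x0 /axis0 /axis1; ring.
by rewrite x1 /axis0 /axis1; ring.
Qed.

End Frame.

(** * Circles tangent to both parents and their unit directions *)

Section Annulus.
Variables (K : rcfType) (gam Gam : circle K).
Local Notation r := (radius gam).
Local Notation R := (radius Gam).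
Local Notation d := (dist (center gam) (center Gam)).
Local Notation absc := (abscissa (center gam) (center Gam)).
Local Notation ordi := (ordinate (center gam) (center Gam)).
Hypothesis rR : r < R.
Hypothesis d_gt0 : 0 < d.
Hypothesis d_sqr : d ^+ 2 = R ^+ 2 - 6%:R * R * r + r ^+ 2.

Lemma circle_eq (e f : circle K) :
  center e = center f -> radius e = radius f -> e = f.
Proof.
case: e f => [ce re he] [cf rf hf] /= cE rE; case: _ / cE hf; case: _ / rE.
by move=> hf; congr Circle; apply: bool_irrelevance.
Qed.

Definition inscribed (e : circle K) : Prop :=
  externally_tangent e gam /\ internally_tangent e Gam.

(* An inversion making [gam] and [Gam] concentric turns the inscribed circles
   into congruent ones; [cosine] and [sine] are the coordinates of their
   direction from the common centre, written without the inversion. *)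
Definition cosine (e : circle K) : K :=
  (2%:R * R * r / radius e - (R - r)) / d.
Definition sine (e : circle K) : K :=
  ordi (center e) / (radius e * Num.sqrt 2%:R).

Let r_gt0 : 0 < r. Proof. exact: radius_gt0. Qed.
Let R_gt0 : 0 < R. Proof. exact: radius_gt0. Qed.
Let d_neq0 : d != 0. Proof. by rewrite gt_eqF. Qed.
Let sqrt2_neq0 : Num.sqrt 2%:R != 0 :> K.
Proof. by rewrite gt_eqF // sqrtr_gt0. Qed.
Let sqrt2_sqr : (Num.sqrt 2%:R : K) ^+ 2 = 2%:R.
Proof. by rewrite sqr_sqrtr. Qed.

(** [d^2 = (R - r)(R - 5r) - 4r^2], so [d^2 > 0] forces [R - 5r > 0]. *)
Lemma ratio_gt5 : 5%:R * r < R.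
Proof.
have := exprn_gt0 2 d_gt0; rewrite d_sqr => h; rewrite ltNge; apply/negP => h5.
have : 0 <= (R - r) * (5%:R * r - R) by rewrite mulr_ge0 ?subr_ge0 // ltW.
have := exprn_gt0 2 r_gt0; lra.
Qed.

(** [(R - 3r)^2 - d^2 = 8r^2]. This bound places [gam] inside [Gam] and keeps the radius attached to
    a direction positive and below [R]. *)
Lemma center_distance_lt : d + 2%:R * r < R - r.
Proof.
have h5 := ratio_gt5; have r0 := r_gt0.
have h3 : 0 <= R - r - 2%:R * r by lra.
rewrite -ltrBrDr -ltr_sqr ?nnegrE ?(ltW d_gt0) // d_sqr; nra.
Qed.

(** Subtracting the squared tangency equations cancels the quadratic terms in the centre and in the
    unknown radius; what is left ties the abscissa linearly to the radius. *)
Lemma inscribedP e :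
  inscribed e <->
  [/\ d * absc (center e) = r * (r - 3%:R * R) + (r + R) * radius e,
      absc (center e) ^+ 2 + ordi (center e) ^+ 2 = (r + radius e) ^+ 2
    & radius e < R].
Proof.
have e_gt0 := radius_gt0 e; have d2 := d_sqr.
rewrite /inscribed /externally_tangent /internally_tangent.
have eg : dist (center e) (center gam) ^+ 2 =
          absc (center e) ^+ 2 + ordi (center e) ^+ 2.
  by rewrite (dist_sqr_coord d_gt0) abscissa_origin ordinate_origin !subr0.
have eG : dist (center e) (center Gam) ^+ 2 =
          (absc (center e) - d) ^+ 2 + ordi (center e) ^+ 2.
  by rewrite (dist_sqr_coord d_gt0) abscissa_axis // ordinate_axis !subr0.
split=> [[h1 [h2 h3]]|[h1 h2 h3]].
  rewrite -eg h1; split => //; last by ring.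
  rewrite h1 in eg; rewrite h3 in eG; lra.
have h4 : 0 <= R - radius e by rewrite subr_ge0 ltW.
split; first by apply/dist_eqP; [rewrite addr_ge0 ?ltW|rewrite eg h2; ring].
split => //; apply/dist_eqP => //.
rewrite eG; lra.
Qed.

Lemma cosineE e : radius e * (R - r + d * cosine e) = 2%:R * R * r.
Proof.
rewrite /cosine; field.
by rewrite d_neq0 gt_eqF // radius_gt0.
Qed.

Lemma sineE e : ordi (center e) = radius e * Num.sqrt 2%:R * sine e.
Proof.
rewrite /sine; field.
by rewrite sqrt2_neq0 gt_eqF // radius_gt0.
Qed.

(** The left side is [d^2] times the defect in the tangency with [gam], the right side a multiple of
    the defect of [(c, s)] from unit length. With [rho], [c], [s] free, it serves both to show that
    directions are unit vectors and to build a circle from a unit vector. *)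
Lemma tangency_identity (rho c s : K) :
  rho * (R - r + d * c) = 2%:R * R * r ->
  d ^+ 2 * (r + rho) ^+ 2 - (r * (r - 3%:R * R) + (r + R) * rho) ^+ 2
    - d ^+ 2 * (rho * Num.sqrt 2%:R * s) ^+ 2
  = 2%:R * d ^+ 2 * rho ^+ 2 * (1 - c ^+ 2 - s ^+ 2).
Proof.
move=> h; rewrite !exprMn sqrt2_sqr.
have {}h : rho * d * c = 2%:R * R * r - (R - r) * rho.
  by rewrite -h; ring.
have h2 : d ^+ 2 * rho ^+ 2 * c ^+ 2
          = (2%:R * R * r - (R - r) * rho) ^+ 2.
  by rewrite -h; ring.
have -> : 2%:R * d ^+ 2 * rho ^+ 2 * (1 - c ^+ 2 - s ^+ 2) =
  2%:R * (d ^+ 2 * rho ^+ 2 - d ^+ 2 * rho ^+ 2 * c ^+ 2)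
   - 2%:R * d ^+ 2 * rho ^+ 2 * s ^+ 2 by ring.
rewrite h2 d_sqr; ring.
Qed.

Lemma unit_direction e : inscribed e -> cosine e ^+ 2 + sine e ^+ 2 = 1.
Proof.
move=> /inscribedP [h1 h2 h3].
have := tangency_identity (sine e) (cosineE e).
rewrite -h1 -h2 -sineE => h.
have e0 : 2%:R * d ^+ 2 * radius e ^+ 2 != 0.
  by rewrite !mulf_neq0 ?expf_neq0 ?pnatr_eq0 // gt_eqF // radius_gt0.
apply/eqP; rewrite eq_sym -subr_eq0 opprD addrA -(inj_eq (mulfI e0)) mulr0 -h.
by apply/eqP; ring.
Qed.

(** The cosine determines the radius, the radius determines the abscissa, and the sine then gives
    the ordinate. *)
Lemma direction_inj e f : inscribed e -> inscribed f ->
  cosine e = cosine f -> sine e = sine f -> e = f.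
Proof.
move=> /inscribedP [e1 _ _] /inscribedP [f1 _ _] hc hs.
have rE : radius e = radius f.
  have e0 := cosineE e; have := cosineE f; rewrite -hc -e0.
  move/mulIf => -> //.
  apply/eqP => h; move: e0; rewrite h mulr0 => /esym/eqP.
  by rewrite !mulf_eq0 pnatr_eq0 !gt_eqF.
apply: circle_eq => //; apply: (abscissa_ordinate_inj d_gt0).
  by apply: (mulfI d_neq0); rewrite e1 f1 rE.
by rewrite !sineE rE hs.
Qed.

Lemma direction_exists c s : c ^+ 2 + s ^+ 2 = 1 ->
  exists e, [/\ inscribed e, cosine e = c & sine e = s].
Proof.
move=> cs1; have dlt := center_distance_lt.
have [d0 [r0 R0]] := (d_gt0, (r_gt0, R_gt0)).
have hc : -1 <= c.
  by have := sqr_ge0 s => ?; rewrite leNgt; apply/negP => ?; nra.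
(* The worst case is [c = -1], which is [center_distance_lt]. The bound [2r], rather than 0, is what
   yields [rho < R]. *)
have den_gt : 2%:R * r < R - r + d * c by nra.
have den_gt0 : 0 < R - r + d * c by lra.
pose rho := 2%:R * R * r / (R - r + d * c).
have rho_gt0 : 0 < rho by rewrite divr_gt0 // !mulr_gt0.
have rhoE : rho * (R - r + d * c) = 2%:R * R * r.
  by rewrite /rho divfK // gt_eqF.
pose x := (r * (r - 3%:R * R) + (r + R) * rho) / d.
have xE : d * x = r * (r - 3%:R * R) + (r + R) * rho.
  by rewrite /x mulrC divfK.
pose y := rho * Num.sqrt 2%:R * s.
exists (Circle (point_at (center gam) (center Gam) x y) rho_gt0).
split.
- apply/inscribedP => /=.
  rewrite abscissa_point_at // ordinate_point_at //; split => //.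
    have := tangency_identity s rhoE; rewrite -xE -/y.
    have -> : 1 - c ^+ 2 - s ^+ 2 = 0 by rewrite -cs1; ring.
    rewrite mulr0 => h; apply: (mulfI (expf_neq0 2 d_neq0)).
    by apply/esym/eqP; rewrite -subr_eq0 -h; apply/eqP; ring.
  by rewrite /rho ltr_pdivrMr //; nra.
- rewrite /cosine /=.
  by rewrite -rhoE mulrAC divff ?gt_eqF //; field.
- rewrite /sine /= ordinate_point_at // /y; field.
  by rewrite sqrt2_neq0 gt_eqF.
Qed.

(* In the concentric picture tangent neighbours are a quarter turn apart. *)
Lemma tangent_orthogonal e f : inscribed e -> inscribed f ->
  externally_tangent e f <-> cosine e * cosine f + sine e * sine f = 0.
Proof.
move=> ie fi; have /inscribedP [e1 _ _] := ie; have /inscribedP [f1 _ _] := fi.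
have e_gt0 := radius_gt0 e; have f_gt0 := radius_gt0 f.
have ue := unit_direction ie; have uf := unit_direction fi.
have ec := cosineE e; have fc := cosineE f.
have sum_ge0 : 0 <= radius e + radius f by rewrite addr_ge0 ?ltW.
rewrite /externally_tangent dist_eqP // (dist_sqr_coord d_gt0) !sineE.
move: (radius e) (radius f) (cosine e) (cosine f) (sine e) (sine f)
  (absc (center e)) (absc (center f)) e1 f1 e_gt0 f_gt0 ue uf ec fc sum_ge0
  => a b c1 c2 s1 s2 x1 x2 e1 f1 a0 b0 ue uf ec fc _.
(* The tangency defect is a nonzero multiple of the inner product of the directions. After
   multiplication by [d^2], abscissas and cosines become polynomials in the radii, and only the
   cross term in [s1 * s2] keeps the sines. *)
have key : (x1 - x2) ^+ 2 + (a * Num.sqrt 2%:R * s1 - b * Num.sqrt 2%:R * s2) ^+ 2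
   - (a + b) ^+ 2 = - (4%:R * a * b * (c1 * c2 + s1 * s2)).
  apply: (mulfI (expf_neq0 2 d_neq0)).
  have X : d * (x1 - x2) = (r + R) * (a - b) by rewrite mulrBr e1 f1; ring.
  have C1 : a * d * c1 = 2%:R * R * r - (R - r) * a by rewrite -ec; ring.
  have C2 : b * d * c2 = 2%:R * R * r - (R - r) * b by rewrite -fc; ring.
  have S1 : s1 ^+ 2 = 1 - c1 ^+ 2 by rewrite -ue; ring.
  have S2 : s2 ^+ 2 = 1 - c2 ^+ 2 by rewrite -uf; ring.
  transitivity ((d * (x1 - x2)) ^+ 2 + d ^+ 2 * Num.sqrt 2%:R ^+ 2 *
     (a ^+ 2 * s1 ^+ 2 + b ^+ 2 * s2 ^+ 2 - 2%:R * a * b * s1 * s2)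
     - d ^+ 2 * (a + b) ^+ 2); first by ring.
  rewrite X sqrt2_sqr S1 S2.
  transitivity ((r + R) ^+ 2 * (a - b) ^+ 2 + 2%:R *
     (d ^+ 2 * a ^+ 2 - (a * d * c1) ^+ 2 + (d ^+ 2 * b ^+ 2 - (b * d * c2) ^+ 2))
     - 4%:R * d ^+ 2 * a * b * s1 * s2
     - d ^+ 2 * (a + b) ^+ 2); first by ring.
  transitivity (- 4%:R * (a * d * c1) * (b * d * c2) -
     4%:R * d ^+ 2 * a * b * s1 * s2); last by ring.
  by rewrite C1 C2 d_sqr; ring.
have ab0 : 4%:R * a * b != 0 by rewrite !mulf_neq0 ?pnatr_eq0 // gt_eqF.
split=> [/eqP|h].
  rewrite -subr_eq0 key oppr_eq0 mulf_eq0 (negPf ab0) /=.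
  by move/eqP.
by apply/eqP; rewrite -subr_eq0 key h mulr0 oppr0.
Qed.

Lemma on_axis_sine e :
  on_line (center gam) (center Gam) (center e) <-> sine e = 0.
Proof.
rewrite on_line_ordinate // sineE; split=> [/eqP|->]; last by rewrite mulr0.
have e_neq0 : radius e != 0 by rewrite gt_eqF // radius_gt0.
rewrite mulf_eq0 => /orP [|/eqP //].
by rewrite mulf_eq0 (negPf sqrt2_neq0) (negPf e_neq0).
Qed.

Section Reflection.
Variable e : circle K.
Local Notation e' := (reflect_circle (center gam) (center Gam) e).

Lemma cosine_reflect : cosine e' = cosine e.
Proof. by []. Qed.

Lemma sine_reflect : sine e' = - sine e.
Proof. by rewrite /sine /= reflect_pointE // ordinate_point_at // mulNr. Qed.

Lemma inscribed_reflect : inscribed e -> inscribed e'.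
Proof.
move=> /inscribedP [h1 h2 h3]; apply/inscribedP => /=.
by rewrite reflect_pointE // abscissa_point_at // ordinate_point_at // sqrrN.
Qed.

End Reflection.

(** The point of [gam] farthest from the centre of [Gam] has abscissa [- r] and lies at distance
    [r + d < R]. *)
Lemma lies_inside_of_ratio : lies_inside gam Gam.
Proof.
have dlt := center_distance_lt; have [d0 r0] := (d_gt0, r_gt0).
rewrite /lies_inside /on_circle /in_open_disk => x hx.
rewrite -ltr_sqr ?nnegrE ?dist_ge0 ?(ltW R_gt0) //.
rewrite (dist_sqr_coord d_gt0) abscissa_axis // ordinate_axis.
have := dist_sqr_coord d_gt0 x (center gam); rewrite hx.
rewrite abscissa_origin ordinate_origin !subr0.
move: (absc x) (ordi x) => u v huv.
have hu : - r <= u.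
  by have := sqr_ge0 v => ?; rewrite leNgt; apply/negP => ?; nra.
have -> : (u - d) ^+ 2 + v ^+ 2 = r ^+ 2 - 2%:R * u * d + d ^+ 2.
  by rewrite huv; ring.
nra.
Qed.

(** * Chains as quarter-turn orbits of a unit vector *)

Lemma Z4_ind (P : 'Z_4 -> Prop) :
  P 0 -> P 1 -> P (1 + 1) -> P (1 + 1 + 1) -> forall i, P i.
Proof.
move=> h0 h1 h2 h3 [[|[|[|[|//]]]] hi].
- by rewrite (_ : Ordinal hi = 0) //; apply: val_inj.
- by rewrite (_ : Ordinal hi = 1) //; apply: val_inj.
- by rewrite (_ : Ordinal hi = 1 + 1) //; apply: val_inj.
- by rewrite (_ : Ordinal hi = 1 + 1 + 1) //; apply: val_inj.
Qed.

Lemma Z4_add4 (i : 'Z_4) : i + 1 + 1 + 1 + 1 = i.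
Proof. by move: i; apply: Z4_ind; apply: val_inj. Qed.

(** By Lagrange's identity the squares of the determinant and of the inner product of two unit
    vectors add up to 1; the determinant is thus the sign of the quarter turn. *)
Lemma orthogonal_unit (c s c' s' : K) :
  c ^+ 2 + s ^+ 2 = 1 -> c' ^+ 2 + s' ^+ 2 = 1 -> c * c' + s * s' = 0 ->
  [/\ (c * s' - s * c') ^+ 2 = 1, c' = - (c * s' - s * c') * s
    & s' = (c * s' - s * c') * c].
Proof.
move=> u u' o; split.
- transitivity ((c ^+ 2 + s ^+ 2) * (c' ^+ 2 + s' ^+ 2) - (c * c' + s * s') ^+ 2).
    by ring.
  by rewrite u u' o; ring.
- transitivity (c' * (c ^+ 2 + s ^+ 2) - c * (c * c' + s * s')); last by ring.
  by rewrite u o; ring.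
- transitivity (s' * (c ^+ 2 + s ^+ 2) - s * (c * c' + s * s')); last by ring.
  by rewrite u o; ring.
Qed.

Lemma parallel_unit (c s c' s' : K) :
  c ^+ 2 + s ^+ 2 = 1 -> c' ^+ 2 + s' ^+ 2 = 1 -> c * s' - s * c' = 0 ->
  [/\ (c * c' + s * s') ^+ 2 = 1, c' = (c * c' + s * s') * c
    & s' = (c * c' + s * s') * s].
Proof.
move=> u u' o; split.
- transitivity ((c ^+ 2 + s ^+ 2) * (c' ^+ 2 + s' ^+ 2) - (c * s' - s * c') ^+ 2).
    by ring.
  by rewrite u u' o; ring.
- transitivity (c' * (c ^+ 2 + s ^+ 2) + s * (c * s' - s * c')); last by ring.
  by rewrite u o; ring.
- transitivity (s' * (c ^+ 2 + s ^+ 2) - c * (c * s' - s * c')); last by ring.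
  by rewrite u o; ring.
Qed.

Lemma sqr1_cases (e : K) : e ^+ 2 = 1 -> e = 1 \/ e = -1.
Proof. by move/eqP; rewrite sqrf_eq1 => /orP [/eqP|/eqP]; [left|right]. Qed.

(* [e = 1] and [e = -1] are the two senses of rotation. *)
Definition turning (e : K) (delta : 'Z_4 -> circle K) : Prop :=
  [/\ e ^+ 2 = 1, forall i, inscribed (delta i),
      forall i, cosine (delta (i + 1)) = - e * sine (delta i)
    & forall i, sine (delta (i + 1)) = e * cosine (delta i)].

Lemma turning2 e delta i : turning e delta ->
  cosine (delta (i + 1 + 1)) = - cosine (delta i) /\
  sine (delta (i + 1 + 1)) = - sine (delta i).
Proof.
move=> [e1 _ hc hs]; rewrite !hc !hs !hc; split.
  by rewrite mulrA mulNr -expr2 e1 mulN1r.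
by rewrite mulrA mulrN -expr2 e1 mulN1r.
Qed.

Lemma turning_steiner e delta : turning e delta -> steiner4_chain gam Gam delta.
Proof.
move=> T; have [e1 ins hc hs] := T.
have orth i : cosine (delta i) * cosine (delta (i + 1))
              + sine (delta i) * sine (delta (i + 1)) = 0.
  by rewrite hc hs; ring.
have neq1 i : delta (i + 1) <> delta i.
  move=> h; have := orth i; rewrite h -!expr2 unit_direction //.
  by move/eqP; rewrite oner_eq0.
have neq2 i : delta (i + 1 + 1) <> delta i.
  move=> h; have [] := turning2 i T; rewrite h => h1 h2.
  have := unit_direction (ins i).
  rewrite (_ : cosine _ = 0); last by lra.
  rewrite (_ : sine _ = 0); last by lra.
  by rewrite expr0n addr0 => /eqP; rewrite eq_sym oner_eq0.
split.
- exact: lies_inside_of_ratio.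
(* Only the offset [j - i] matters. Offsets 1 and 2 give orthogonal and opposite unit vectors;
   offset 3 is offset 1 seen from the other end. *)
- move=> i j hij; apply/eqP; rewrite eq_sym -subr_eq0; apply/eqP.
  have : delta (i + (j - i)) = delta i by rewrite addrC subrK.
  move: (j - i); apply: Z4_ind => //.
  + by move/neq1.
  + by rewrite addrA => /neq2.
  + rewrite !addrA => h; have := neq1 (i + 1 + 1 + 1).
    by rewrite Z4_add4 h.
- by move=> i; apply/tangent_orthogonal.
- by move=> i; have [] := ins i.
- by move=> i; have [] := ins i.
Qed.

Lemma steiner_turning delta :
  steiner4_chain gam Gam delta -> exists e, turning e delta.
Proof.
move=> [_ inj tan tg tG].
have ins i : inscribed (delta i) by [].
pose ee i := cosine (delta i) * sine (delta (i + 1))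
            - sine (delta i) * cosine (delta (i + 1)).
have step i : [/\ ee i ^+ 2 = 1,
    cosine (delta (i + 1)) = - ee i * sine (delta i)
  & sine (delta (i + 1)) = ee i * cosine (delta i)].
  apply: orthogonal_unit; try exact: unit_direction.
  by apply/tangent_orthogonal.
(* If the sign flipped, the second quarter turn would undo the first, so circles [i] and [i + 2]
   would coincide, against injectivity. *)
have const i : ee (i + 1) = ee i.
  have [e1 c1 s1] := step i; have [e2 c2 s2] := step (i + 1).
  move/eqP: e2; rewrite -e1 eqf_sqr => /orP [/eqP //|/eqP e2].
  have : delta (i + 1 + 1) = delta i.
    apply: direction_inj => //.
      by rewrite c2 s1 e2 opprK mulrA -expr2 e1 mul1r.
    by rewrite s2 c1 e2 mulrA mulrNN -expr2 e1 mul1r.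
  by move/inj/eqP; rewrite -addrA -[X in _ == X]addr0 (inj_eq (addrI i)).
have ee0 : forall i, ee i = ee 0.
  have h1 := const 0; rewrite add0r in h1.
  by apply: Z4_ind => //; rewrite ?const.
exists (ee 0); split => // [|i|i]; first by have [] := step 0.
  by have [_ -> _] := step i; rewrite ee0.
by have [_ _ ->] := step i; rewrite ee0.
Qed.

Lemma turning_exists (e c s : K) : e ^+ 2 = 1 -> c ^+ 2 + s ^+ 2 = 1 ->
  exists delta, [/\ turning e delta, cosine (delta 0) = c & sine (delta 0) = s].
Proof.
move=> e1 cs.
have [f0 [i0 c0 s0]] := direction_exists cs.
have cs1 : (- e * s) ^+ 2 + (e * c) ^+ 2 = 1.
  by rewrite !exprMn sqrrN e1 !mul1r addrC.
have [f1 [i1 c1 s1]] := direction_exists cs1.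
have cs2 : (- c) ^+ 2 + (- s) ^+ 2 = 1 by rewrite !sqrrN.
have [f2 [i2 c2 s2]] := direction_exists cs2.
have cs3 : (e * s) ^+ 2 + (- e * c) ^+ 2 = 1.
  by rewrite !exprMn sqrrN e1 !mul1r addrC.
have [f3 [i3 c3 s3]] := direction_exists cs3.
(* The default [f0] is never reached, since an element of ['Z_4] is below 4. *)
exists (fun i : 'Z_4 => nth f0 [:: f0; f1; f2; f3] i); split => //=.
have ee x : e * (e * x) = x by rewrite mulrA -expr2 e1 mul1r.
split => //; apply: Z4_ind => //=;
  by rewrite ?c0 ?c1 ?c2 ?c3 ?s0 ?s1 ?s2 ?s3 ?mulNr ?mulrN ?mulNr ?ee ?opprK.
Qed.

(** With [t] the angle from the direction of [delta 0] to that of [f], the product is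
    [cos t * sin t]; it vanishes exactly when [t] is a multiple of a quarter turn. *)
Lemma turning_member e delta f : turning e delta -> inscribed f ->
  (cosine (delta 0) * cosine f + sine (delta 0) * sine f)
  * (cosine (delta 0) * sine f - sine (delta 0) * cosine f) = 0 ->
  exists i, delta i = f.
Proof.
move=> T fi; have [e1 ins hc hs] := T.
have u0 := unit_direction (ins 0); have uf := unit_direction fi.
have [c2 s2] := turning2 0 T; have [c3 s3] := turning2 (0 + 1) T.
have hc0 := hc 0; have hs0 := hs 0.
move/eqP; rewrite mulf_eq0 => /orP [/eqP o|/eqP o].
  have [eps1 cf sf] := orthogonal_unit u0 uf o.
  (* A quarter turn in the sense of the chain is one step forward; against it, three steps. *)
  move/eqP: eps1; rewrite -e1 eqf_sqr => /orP [/eqP E|/eqP E].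
    exists (0 + 1); apply: direction_inj => //.
      by rewrite hc0 cf E.
    by rewrite hs0 sf E.
  exists (0 + 1 + 1 + 1); apply: direction_inj => //.
    by rewrite c3 hc0 cf E !mulNr.
  by rewrite s3 hs0 sf E mulNr.
have [/sqr1_cases [] E cf sf] := parallel_unit u0 uf o.
  exists 0; apply: direction_inj => //.
    by rewrite cf E mul1r.
  by rewrite sf E mul1r.
exists (0 + 1 + 1); apply: direction_inj => //.
  by rewrite c2 cf E mulN1r.
by rewrite s2 sf E mulN1r.
Qed.

Lemma turning_shift e delta eps k : turning e delta -> turning e eps ->
  delta k = eps 0 -> forall i, eps i = delta (i + k).
Proof.
move=> [_ i1 c1 s1] [_ i2 c2 s2] h0.
have step i : eps i = delta (i + k) -> eps (i + 1) = delta (i + 1 + k).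
  move=> h; apply: direction_inj => //; rewrite addrAC.
    by rewrite c1 c2 h.
  by rewrite s1 s2 h.
have h1 : eps 0 = delta (0 + k) by rewrite add0r.
have h2 := step 0 h1; rewrite [0 + 1]add0r in h2.
have h3 := step _ h2; have h4 := step _ h3.
exact: Z4_ind h1 h2 h3 h4.
Qed.

(** The sense is the determinant of two consecutive directions, so it can be read off the sequence.
    This separates the two lateral chains. *)
Lemma turning_sense_unique e e' delta :
  turning e delta -> turning e' delta -> e = e'.
Proof.
move=> [_ ins c s] [_ _ c' s'].
have u := unit_direction (ins 0).
have h1 := c 0; rewrite c' in h1; have h2 := s 0; rewrite s' in h2.
apply/eqP; rewrite -subr_eq0 -[e - e']mulr1 -u; apply/eqP.
transitivity (cosine (delta 0) * (e * cosine (delta 0) - e' * cosine (delta 0))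
  + sine (delta 0) * (- e' * sine (delta 0) - - e * sine (delta 0))).
  by ring.
by rewrite h1 h2 !subrr !mulr0 addr0.
Qed.

(** * The sum of the radii and its bounds *)

Lemma turning_radii_sum e delta : turning e delta ->
  radii_sum delta = 4%:R * R * r * (R - r) * (R + r) ^+ 2 /
    (4%:R * R * r * (R - r) ^+ 2
     + d ^+ 4 * (cosine (delta 0) * sine (delta 0)) ^+ 2).
Proof.
move=> T; have [e1 ins hc hs] := T.
have [c2 _] := turning2 0 T; have [c3 _] := turning2 (0 + 1) T.
have := cosineE (delta (0 + 1 + 1 + 1)); have := cosineE (delta (0 + 1 + 1)).
have := cosineE (delta (0 + 1)); have := cosineE (delta 0).
rewrite c3 c2 hc.
have -> : radii_sum delta = radius (delta 0) + radius (delta (0 + 1))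
   + radius (delta (0 + 1 + 1)) + radius (delta (0 + 1 + 1 + 1)).
  rewrite /radii_sum !big_ord_recl big_ord0 addr0 !addrA.
  by congr (radius (delta _) + radius (delta _) + radius (delta _)
            + radius (delta _)); apply: val_inj.
have := unit_direction (ins 0).
move: (cosine _) (sine _) => c s u.
move: (radius (delta 0)) (radius (delta (0 + 1))) (radius (delta (0 + 1 + 1)))
  (radius (delta (0 + 1 + 1 + 1))) => r0 r1 r2 r3 h0 h1 h2 h3.
have Rr : 2%:R * R * r != 0 by rewrite !mulf_neq0 ?pnatr_eq0 // gt_eqF.
(* Each radius is [2Rr / k]. Opposite circles are paired because [k0 + k2 = k1 + k3 = 2(R - r)];
   moreover [k0 * k2 + k1 * k3 = 2(R - r)^2 - d^2 = (R + r)^2]. *)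
pose k0 := R - r + d * c; pose k1 := R - r + d * (- e * s).
pose k2 := R - r + d * - c; pose k3 := R - r + d * - (- e * s).
have nz x k : x * k = 2%:R * R * r -> k != 0.
  by move=> h; apply/eqP => k_0; move: Rr; rewrite -h k_0 mulr0 eqxx.
have den : k0 * k2 * (k1 * k3) =
  4%:R * R * r * (R - r) ^+ 2 + d ^+ 4 * (c * s) ^+ 2.
  have -> : k1 * k3 = (R - r) ^+ 2 - d ^+ 2 * s ^+ 2.
    transitivity ((R - r) ^+ 2 - d ^+ 2 * (e ^+ 2 * s ^+ 2)).
      by rewrite /k1 /k3; ring.
    by rewrite e1 mul1r.
  transitivity ((R - r) ^+ 2 * ((R - r) ^+ 2 - d ^+ 2 * (c ^+ 2 + s ^+ 2))
                + d ^+ 4 * (c * s) ^+ 2).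
    by rewrite /k0 /k2; ring.
  by rewrite u d_sqr; ring.
have den0 : k0 * k2 * (k1 * k3) != 0.
  by rewrite !mulf_neq0 // ?(nz _ _ h0) ?(nz _ _ h1) ?(nz _ _ h2) ?(nz _ _ h3).
apply: (mulIf den0); rewrite {2}den divfK -?den //.
transitivity ((r0 * k0 * k2 + r2 * k2 * k0) * (k1 * k3)
              + (r1 * k1 * k3 + r3 * k3 * k1) * (k0 * k2)); first by ring.
rewrite h0 h1 h2 h3.
transitivity (4%:R * R * r * (R - r) * (k0 * k2 + k1 * k3)).
  by rewrite /k0 /k1 /k2 /k3; ring.
have -> : k0 * k2 + k1 * k3 = 2%:R * (R - r) ^+ 2
   - d ^+ 2 * (c ^+ 2 + e ^+ 2 * s ^+ 2) by rewrite /k0 /k1 /k2 /k3; ring.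
by rewrite e1 mul1r u d_sqr; ring.
Qed.

Definition max_sum : K := (R + r) ^+ 2 / (R - r).
Definition min_sum : K := 16%:R * R * r * (R - r) / (R + r) ^+ 2.

Let D_gt0 : 0 < R - r. Proof. by rewrite subr_gt0. Qed.
Let num_gt0 : 0 < 4%:R * R * r * (R - r) * (R + r) ^+ 2.
Proof.
have sum_gt0 : 0 < R + r by rewrite addr_gt0.
by rewrite !mulr_gt0 ?exprn_gt0.
Qed.
Let den_gt0 : 0 < 4%:R * R * r * (R - r) ^+ 2.
Proof. by rewrite !mulr_gt0 ?exprn_gt0. Qed.

(** Over the numerator of [turning_radii_sum], comparing sums amounts to comparing denominators. *)
Lemma max_sumE : max_sum = 4%:R * R * r * (R - r) * (R + r) ^+ 2 /
    (4%:R * R * r * (R - r) ^+ 2).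
Proof. by rewrite /max_sum; field; rewrite !gt_eqF. Qed.

Lemma min_sumE : min_sum = 4%:R * R * r * (R - r) * (R + r) ^+ 2 /
    (4%:R * R * r * (R - r) ^+ 2 + d ^+ 4 * 4%:R^-1).
Proof.
(* Since [d^2 = (R - r)^2 - 4Rr], the left side is a quarter of the square of [(R - r)^2 + 4Rr]. *)
have -> : 4%:R * R * r * (R - r) ^+ 2 + d ^+ 4 * 4%:R^-1
          = (R + r) ^+ 4 / 4%:R.
  by rewrite [d ^+ 4](exprM _ 2 2) d_sqr; field.
by rewrite /min_sum; field; rewrite gt_eqF // addr_gt0.
Qed.

Lemma radii_sum_le delta :
  steiner4_chain gam Gam delta -> radii_sum delta <= max_sum.
Proof.
move=> /steiner_turning [e T]; rewrite (turning_radii_sum T) max_sumE.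
have h : 0 <= d ^+ 4 * (cosine (delta 0) * sine (delta 0)) ^+ 2.
  by rewrite mulr_ge0 ?sqr_ge0 // exprn_ge0 // ltW.
by rewrite ler_pM2l // lef_pV2 ?posrE ?lerDl // ltr_pwDl.
Qed.

Lemma radii_sum_ge delta :
  steiner4_chain gam Gam delta -> min_sum <= radii_sum delta.
Proof.
move=> /steiner_turning [e T]; rewrite (turning_radii_sum T) min_sumE.
have [_ ins _ _] := T; have := unit_direction (ins 0).
move: (cosine _) (sine _) => c s u.
have d4 : 0 < d ^+ 4 by rewrite exprn_gt0.
have h : 0 <= d ^+ 4 * (c * s) ^+ 2 by rewrite mulr_ge0 ?sqr_ge0 // ltW.
(* The gap is [(c^2 - s^2)^2 / 4]. *)
have quarter : (c * s) ^+ 2 <= 4%:R^-1.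
  have -> : 4%:R^-1 = (c ^+ 2 + s ^+ 2) ^+ 2 / 4%:R :> K.
    by rewrite u expr1n mul1r.
  have := sqr_ge0 (c ^+ 2 - s ^+ 2); lra.
rewrite ler_pM2l // lef_pV2 ?posrE; first by rewrite lerD2l ler_pM2l.
  by rewrite addr_gt0 // mulr_gt0 // invr_gt0.
by rewrite ltr_pwDl.
Qed.

(** * Axial chains *)

Lemma axial_turning delta : axial_chain gam Gam delta ->
  exists2 e, turning e delta & cosine (delta 0) * sine (delta 0) = 0.
Proof.
move=> [/steiner_turning [e T] [i [_ [_ /on_axis_sine si _]]]].
exists e => //; have [_ _ hc hs] := T.
have [c2 s2] := turning2 0 T; have [c3 s3] := turning2 (0 + 1) T.
have e0 : e != 0.
  have [e1 _ _ _] := T; apply/eqP => E; move/eqP: e1.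
  by rewrite E expr0n eq_sym oner_eq0.
have hs0 := hs 0.
rewrite [0 + 1]add0r in c2 s2 c3 s3 hs0.
(* A quarter turn exchanges sine and cosine up to sign, so a zero sine at [i] becomes a zero sine or
   cosine at index 0. *)
move: i si; apply: Z4_ind.
- by move=> ->; rewrite mulr0.
- move/eqP; rewrite hs0 mulf_eq0 (negPf e0) => /eqP ->.
  by rewrite mul0r.
- by rewrite s2 => /eqP; rewrite oppr_eq0 => /eqP ->; rewrite mulr0.
- move/eqP; rewrite s3 oppr_eq0 hs0 mulf_eq0 (negPf e0) => /eqP ->.
  by rewrite mul0r.
Qed.

Lemma axial_radii_sum delta :
  axial_chain gam Gam delta -> radii_sum delta = max_sum.
Proof.
move=> /axial_turning [e T h]; rewrite (turning_radii_sum T) h.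
by rewrite max_sumE expr0n mulr0 addr0.
Qed.

Lemma axial_exists : exists delta, axial_chain gam Gam delta.
Proof.
(* Direction [(1, 0)] is that of the smallest circle, of radius [(R - r - d) / 2]; the opposite
   circle has direction [(-1, 0)]. *)
have u : (1 : K) ^+ 2 + 0 ^+ 2 = 1 by rewrite expr1n expr0n addr0.
have [delta [T c0 s0]] := turning_exists (expr1n _ 2) u.
exists delta; split; first exact: turning_steiner T.
have [_ s2] := turning2 0 T.
exists 0, (0 + 1 + 1); split => //; apply/on_axis_sine => //.
by rewrite s2 s0 oppr0.
Qed.

Lemma turning_product_sqr e delta i : turning e delta ->
  (cosine (delta i) * sine (delta i)) ^+ 2
  = (cosine (delta 0) * sine (delta 0)) ^+ 2.
Proof.
move=> T; have [e1 _ hc hs] := T.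
have step j : (cosine (delta (j + 1)) * sine (delta (j + 1))) ^+ 2
              = (cosine (delta j) * sine (delta j)) ^+ 2.
  rewrite hc hs.
  transitivity ((e ^+ 2) ^+ 2 * (cosine (delta j) * sine (delta j)) ^+ 2).
    by ring.
  by rewrite e1 expr1n mul1r.
have step0 := step 0; rewrite [0 + 1]add0r in step0.
by move: i; apply: Z4_ind; rewrite ?step.
Qed.

(** All directions involved lie on the coordinate axes, hence differ by quarter turns. Sets of
    circles are compared because the four circles can be run through in either sense. *)
Lemma axial_same_circles delta eps :
  axial_chain gam Gam delta -> axial_chain gam Gam eps ->
  same_circles delta eps.
Proof.
have sub e f d1 d2 : turning e d1 -> turning f d2 ->
    cosine (d1 0) * sine (d1 0) = 0 -> cosine (d2 0) * sine (d2 0) = 0 ->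
    forall i, exists j, d2 j = d1 i.
  move=> T1 T2 h1 h2 i; have [_ ins _ _] := T1.
  apply: (turning_member T2 (ins i)).
  have := turning_product_sqr i T1; rewrite h1 expr0n => /eqP.
  rewrite expf_eq0 /= => /eqP h3.
  transitivity (cosine (d2 0) ^+ 2 * (cosine (d1 i) * sine (d1 i))
   - cosine (d2 0) * sine (d2 0) * cosine (d1 i) ^+ 2
   + cosine (d2 0) * sine (d2 0) * sine (d1 i) ^+ 2
   - sine (d2 0) ^+ 2 * (cosine (d1 i) * sine (d1 i))).
    by ring.
  by rewrite h2 h3; ring.
move=> /axial_turning [e T1 h1] /axial_turning [f T2 h2] c.
split=> [[i <-]|[i <-]].
  exact: sub T1 T2 h1 h2 i.
exact: sub T2 T1 h2 h1 i.
Qed.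

(** * Lateral chains *)

Lemma lateral_turning delta : lateral_chain gam Gam delta ->
  exists2 e, turning e delta & cosine (delta 0) ^+ 2 = sine (delta 0) ^+ 2.
Proof.
move=> [/steiner_turning [e T] sym off]; exists e => //.
have {}off i : sine (delta i) != 0.
  by apply/eqP => h; apply: (off i); apply/on_axis_sine.
have [e1 _ hc hs] := T; have [j hj] := sym 0.
have := cosine_reflect (delta 0); have := sine_reflect (delta 0); rewrite -hj.
(* The sine of the next circle is [e] times the cosine at 0, so its centre being off the axis gives
   a nonzero cosine. *)
have := off (0 + 1); rewrite hs mulf_eq0 negb_or => /andP [_ c0].
have s0 := off 0; have hc0 := hc 0; have hs0 := hs 0.
have [c2 s2] := turning2 0 T; have [c3 s3] := turning2 (0 + 1) T.
rewrite [0 + 1]add0r in c2 s2 c3 s3 hc0 hs0.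
have self (x : K) : x != 0 -> x <> - x.
  by move=> x0 h; move/eqP: x0; apply; lra.
have quarter (x : K) : x ^+ 2 = 1 -> x * sine (delta 0) = cosine (delta 0) ->
    cosine (delta 0) ^+ 2 = sine (delta 0) ^+ 2.
  by move=> x1 <-; rewrite exprMn x1 mul1r.
(* The mirror image [(c, -s)] of direction 0 is neither [(c, s)] nor [(-c, -s)], as [s] and [c] are
   nonzero; so it is a neighbour, whence [c = s] or [c = -s]. *)
move: j {hj}; apply: Z4_ind.
- by move/(self _ s0).
- by move=> _; rewrite hc0; apply: quarter; rewrite sqrrN.
- by move=> _; rewrite c2 => /esym /(self _ c0).
- by move=> _; rewrite c3 hc0 mulNr opprK; apply: quarter.
Qed.

Lemma diagonal_quarter (c s : K) : c ^+ 2 + s ^+ 2 = 1 -> c ^+ 2 = s ^+ 2 ->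
  (c * s) ^+ 2 = 4%:R^-1.
Proof.
move=> u h; rewrite exprMn h.
have -> : s ^+ 2 = 2%:R^-1 by lra.
by field.
Qed.

Lemma lateral_radii_sum delta :
  lateral_chain gam Gam delta -> radii_sum delta = min_sum.
Proof.
move=> /lateral_turning [e T h]; rewrite (turning_radii_sum T).
have [_ ins _ _] := T.
by rewrite (diagonal_quarter (unit_direction (ins 0)) h) min_sumE.
Qed.

Lemma turning_diagonal e delta i : turning e delta ->
  cosine (delta 0) ^+ 2 = sine (delta 0) ^+ 2 ->
  cosine (delta i) ^+ 2 = sine (delta i) ^+ 2.
Proof.
move=> [e1 _ hc hs] h.
have step j : cosine (delta j) ^+ 2 = sine (delta j) ^+ 2 ->
    cosine (delta (j + 1)) ^+ 2 = sine (delta (j + 1)) ^+ 2.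
  by move=> hj; rewrite hc hs [LHS]exprMn [RHS]exprMn sqrrN hj.
have h1 := step 0 h; rewrite [0 + 1]add0r in h1.
have h2 := step _ h1; have h3 := step _ h2.
by move: i; apply: Z4_ind.
Qed.

(** Directions on the two diagonals differ by quarter turns. *)
Lemma diagonal_member e delta f : turning e delta -> inscribed f ->
  cosine (delta 0) ^+ 2 = sine (delta 0) ^+ 2 ->
  cosine f ^+ 2 = sine f ^+ 2 -> exists i, delta i = f.
Proof.
move=> T fi h hf; apply: (turning_member T fi).
transitivity (cosine f * sine f * (cosine (delta 0) ^+ 2 - sine (delta 0) ^+ 2)
  - cosine (delta 0) * sine (delta 0) * (cosine f ^+ 2 - sine f ^+ 2)).
  by ring.
by rewrite h hf; ring.
Qed.

Lemma turning_lateral e delta : turning e delta ->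
  cosine (delta 0) ^+ 2 = sine (delta 0) ^+ 2 -> lateral_chain gam Gam delta.
Proof.
move=> T h; have [_ ins _ _] := T.
split; first exact: turning_steiner T.
- move=> i; apply: (diagonal_member T) => //.
    exact: inscribed_reflect.
  by rewrite cosine_reflect sine_reflect sqrrN; apply: turning_diagonal T h.
- move=> i /on_axis_sine s0.
  have := unit_direction (ins i); rewrite (turning_diagonal i T h) s0.
  by rewrite expr0n addr0 => /eqP; rewrite eq_sym oner_eq0.
Qed.

(** The two chains run through the same four diagonal circles in opposite senses; as cyclic
    sequences they differ, and any lateral chain is a shift of the one sharing its sense. *)
Lemma two_lateral : exists delta eps,
  [/\ lateral_chain gam Gam delta, lateral_chain gam Gam eps,
      ~ same_cyclic_sequence delta eps
    & forall zeta, lateral_chain gam Gam zeta ->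
        same_cyclic_sequence delta zeta \/ same_cyclic_sequence eps zeta].
Proof.
pose h : K := (Num.sqrt 2%:R)^-1.
have hh : h ^+ 2 + h ^+ 2 = 1 by rewrite /h exprVn sqrt2_sqr; field.
have [delta [T1 c1 s1]] := turning_exists (expr1n _ 2) hh.
have N1 : (-1 : K) ^+ 2 = 1 by rewrite sqrrN expr1n.
have [eps [T2 c2 s2]] := turning_exists N1 hh.
have diag1 : cosine (delta 0) ^+ 2 = sine (delta 0) ^+ 2 by rewrite c1 s1.
have diag2 : cosine (eps 0) ^+ 2 = sine (eps 0) ^+ 2 by rewrite c2 s2.
exists delta, eps; split.
- exact: turning_lateral T1 diag1.
- exact: turning_lateral T2 diag2.
- move=> [k hk].
  (* A shift preserves the sense, so [eps] would turn in the sense 1 as well as -1. *)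
  have T3 : turning 1 eps.
    have [o ins hc hs] := T1; split => // i; rewrite !hk //.
      by rewrite addrAC hc.
    by rewrite addrAC hs.
  have := turning_sense_unique T2 T3; lra.
- move=> zeta /lateral_turning [e T3 diag3].
  have [o ins _ _] := T3; case: (sqr1_cases o) => E; rewrite E in T3.
    left; have [k hk] := diagonal_member T1 (ins 0) diag1 diag3.
    by exists k; apply: turning_shift T1 T3 hk.
  right; have [k hk] := diagonal_member T2 (ins 0) diag2 diag3.
  by exists k; apply: turning_shift T2 T3 hk.
Qed.

End Annulus.

(** * The extremal values in terms of curvatures *)

Theorem theorem3 (K : rcfType) (R r d : K) (Gam gam : circle K)
  (hr : 0 < r) (hrR : r < R) (hd : 0 < d)
  (hdRr : d ^+ 2 = R ^+ 2 - 6%:R * R * r + r ^+ 2)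
  (hGam : radius Gam = R) (hgam : radius gam = r)
  (hcent : dist (center gam) (center Gam) = d) :
  let a := r^-1 in
  let A := - R^-1 in
  let Lmax := - ((A ^+ 2 - 2%:R * A * a + a ^+ 2) / (A * a * (a + A))) in
  let Lmin := 16%:R * (A + a) / (A ^+ 2 - 2%:R * A * a + a ^+ 2) in
  (* the axial chain exists and is unique up to the numbering of its circles *)
  ((exists delta, axial_chain gam Gam delta) /\
   (forall delta eps, axial_chain gam Gam delta -> axial_chain gam Gam eps ->
      same_circles delta eps)) /\
  (* there are exactly two lateral chains, as cyclic sequences of circles *)
  (exists delta eps,
     [/\ lateral_chain gam Gam delta, lateral_chain gam Gam eps,
         ~ same_cyclic_sequence delta eps
       & forall zeta, lateral_chain gam Gam zeta ->
           same_cyclic_sequence delta zeta \/ same_cyclic_sequence eps zeta]) /\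
  (* the maximum *)
  ((forall delta, steiner4_chain gam Gam delta -> radii_sum delta <= Lmax) /\
   (forall delta, axial_chain gam Gam delta -> radii_sum delta = Lmax)) /\
  (* the minimum *)
  ((forall delta, steiner4_chain gam Gam delta -> Lmin <= radii_sum delta) /\
   (forall delta, lateral_chain gam Gam delta -> radii_sum delta = Lmin)).
Proof.
move=> a A Lmax Lmin; subst R r d.
have r0 := radius_gt0 gam; have R0 := radius_gt0 Gam.
have D0 : radius Gam - radius gam != 0 by rewrite gt_eqF // subr_gt0.
have S0 : radius Gam + radius gam != 0 by rewrite gt_eqF // addr_gt0.
have [rn Rn] : radius gam != 0 /\ radius Gam != 0 by rewrite !gt_eqF.
have -> : Lmax = max_sum gam Gam.
  by rewrite /Lmax /a /A /max_sum; field; rewrite rn Rn D0.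
have -> : Lmin = min_sum gam Gam.
  (* As the square of [a - A = (R + r) / (R r)], the denominator is visibly nonzero. *)
  have -> : Lmin = 16%:R * (A + a) / (a - A) ^+ 2.
    by rewrite /Lmin; congr (_ / _); ring.
  have -> : a - A = (radius Gam + radius gam) / (radius Gam * radius gam).
    by rewrite /a /A; field; rewrite rn Rn.
  by rewrite /a /A /min_sum; field; rewrite rn Rn S0.
split; [split|split; [|split; split]].
- exact: axial_exists.
- exact: axial_same_circles.
- exact: two_lateral.
- exact: radii_sum_le.
- exact: axial_radii_sum.
- exact: radii_sum_ge.
- exact: lateral_radii_sum.
Qed.
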